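(* (Correctness of the NO-I algorithm.) Let $\mathbb{D}=\langle (E_1,t_1),\ldots,(E_n,t_n)\rangle$ be an event sequence with $t_1<\cdots<t_n$ and let $\alpha$ be an $N$-node serial episode. Then the set of occurrences of $\alpha$ tracked by the NO-I algorithm run on $\mathbb{D}$ is a maximal non-overlapped set of occurrences of $\alpha$ in $\mathbb{D}$: its members are pairwise non-overlapped, and its cardinality is at least that of any other set of pairwise non-overlapped occurrences of $\alpha$ in $\mathbb{D}$.
   Context: An event sequence is $\mathbb{D}=\langle (E_1,t_1),\ldots,(E_n,t_n)\rangle$, where each event-type $E_i$ belongs to a finite alphabet and each $t_i$ is a positive integer. An $N$-node serial episode is a sequence of event-types $\alpha=(\alpha[1]\to\cdots\to\alpha[N])$ with nodes $v_1,\ldots,v_N$. An occurrence of $\alpha$ in $\mathbb{D}$ is a map $h:\{v_1,\ldots,v_N\}\to\{1,\ldots,n\}$ with $E_{h(v_i)}=\alpha[i]$ for all $i$ and $t_{h(v_1)}<\cdots<t_{h(v_N)}$. Two occurrences $h_1,h_2$ are non-overlapped if $t_{h_1(v_N)}<t_{h_2(v_1)}$ or $t_{h_2(v_N)}<t_{h_1(v_1)}$. Automata. An automaton for $\alpha$ has states $0,1,\ldots,N$; in state $j<N$ it waits for an event of type $\alpha[j+1]$, and on accepting such an event it moves to state $j+1$. State $0$ is the start state and state $N$ the final state. An automaton reaching state $N$ has tracked the occurrence consisting of the $N$ events it accepted; the occurrences tracked by the algorithm are those tracked by automata that reach state $N$. The NO-I algorithm. Initially there is one automaton, in state $0$. The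 events are processed in time order. When event $(E_l,t_l)$ is processed: (1) every automaton present before this event and waiting for event-type $E_l$ accepts it and moves to its next state (each automaton makes at most one transition per event); whenever an automaton leaves state $0$, a new automaton is placed in state $0$ (it does not process the current event); (2) if, as a result, an automaton has moved into a state $j$ with $0<j<N$ in which an automaton initialized earlier is still present (that one did not move on this event), the earlier-initialized automaton is removed; (3) if an automaton has reached state $N$, the frequency is incremented by $1$, and all automata for $\alpha$ are removed and replaced by a single automaton in state $0$ (which starts processing from the next event). *)

(* Defs.v *)
From mathcomp Require Import all_boot.

Set Implicit Arguments.
Unset Strict Implicit.
Unset Printing Implicit Defensive.

(* Events are indexed from 0.  An N-node episode is an [m.+1.-tuple] with
   N = m.+1, since it has a first node v_1 ([ord0]) and a last node v_N
   ([ord_max]). *)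

Section Occurrences.

Variables (Sigma : finType) (n : nat) (D : n.-tuple (Sigma * nat)).
Variables (m : nat) (alpha : m.+1.-tuple Sigma).

Definition etype (i : 'I_n) : Sigma := (tnth D i).1.
Definition etime (i : 'I_n) : nat := (tnth D i).2.

Definition occurrence (h : {ffun 'I_m.+1 -> 'I_n}) : Prop :=
  (forall i, etype (h i) = tnth alpha i) /\
  (forall i j : 'I_m.+1, i < j -> etime (h i) < etime (h j)).

Definition non_overlapped (h1 h2 : {ffun 'I_m.+1 -> 'I_n}) : Prop :=
  etime (h1 ord_max) < etime (h2 ord0) \/
  etime (h2 ord_max) < etime (h1 ord0).

Definition occurrence_set (H : {set {ffun 'I_m.+1 -> 'I_n}}) : Prop :=
  forall h, h \in H -> occurrence h.

Definition pairwise_non_overlapped (H : {set {ffun 'I_m.+1 -> 'I_n}}) : Prop :=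
  forall h1 h2, h1 \in H -> h2 \in H -> h1 != h2 -> non_overlapped h1 h2.

Definition maximal_non_overlapped
    (H : {set {ffun 'I_m.+1 -> 'I_n}}) : Prop :=
  [/\ occurrence_set H,
      pairwise_non_overlapped H &
      forall H', occurrence_set H' -> pairwise_non_overlapped H' ->
        #|H'| <= #|H| ].

End Occurrences.

(* [birth] is the number of events already processed when the automaton was
   initialized; [accepted] lists the accepted events in order of acceptance,
   so that its length is the state. *)
Record automaton (n : nat) := Automaton {
  birth : nat;
  accepted : seq 'I_n
}.

Definition astate n (a : automaton n) : nat := size (accepted a).

Definition fresh n (b : nat) : automaton n := Automaton b [::].

Definition accept n (l : 'I_n) (a : automaton n) : automaton n :=
  Automaton (birth a) (rcons (accepted a) l).

Record run_state (n m : nat) := RunState {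
  automata : seq (automaton n);
  frequency : nat;
  tracked : seq {ffun 'I_m.+1 -> 'I_n}
}.

Section NOI.

Variables (Sigma : finType) (n : nat) (D : n.-tuple (Sigma * nat)).
Variables (m : nat) (alpha : m.+1.-tuple Sigma).

(* In state j the automaton waits for alpha[j+1], the entry of index j of
   [alpha]; in the final state [onth] is [None], and it waits for nothing. *)
Definition waits_for (a : automaton n) (e : Sigma) : bool :=
  onth alpha (astate a) == Some e.

(* Only applied when [accepted a] has length m.+1: the default [l] is unused. *)
Definition tracked_by (l : 'I_n) (a : automaton n) : {ffun 'I_m.+1 -> 'I_n} :=
  [ffun i : 'I_m.+1 => nth l (accepted a) i].

Definition superseded (moved : seq (automaton n)) (b : automaton n) : bool :=
  has (fun a => [&& 0 < astate a < m.+1, astate b == astate a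
                  & birth b < birth a]) moved.

Definition noi_step (s : run_state n m) (l : 'I_n) : run_state n m :=
  let A := automata s in
  let w := fun a => waits_for a (etype D l) in
  let moved := [seq accept l a | a <- A & w a] in
  let stayed := [seq a <- A | ~~ w a] in
  let spawned := [seq fresh n l.+1 | a <- A & w a && (astate a == 0)] in
  let kept := [seq b <- stayed | ~~ superseded moved b] in
  let A' := moved ++ kept ++ spawned in
  let final := [seq a <- A' | astate a == m.+1] in
  if nilp final then RunState A' (frequency s) (tracked s)
  else RunState [:: fresh n l.+1] (frequency s).+1
         (tracked s ++ [seq tracked_by l a | a <- final]).

Definition noi_init : run_state n m := RunState [:: fresh n 0] 0 [::].

(* [enum 'I_n] is increasing; this is the time order when the times are. *)
Definition noi_run : run_state n m := foldl noi_step noi_init (enum 'I_n).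

Definition noi_tracked : {set {ffun 'I_m.+1 -> 'I_n}} :=
  [set h in tracked noi_run].

End NOI.

(* Main.v *)
Require Import Defs.
From HB Require Import structures.
From mathcomp Require Import all_boot zify.

Set Implicit Arguments.
Unset Strict Implicit.
Unset Printing Implicit Defensive.

(** Between two resets, the most advanced automaton is in state j exactly when j
   is the length of the longest prefix of the episode embedded in the events
   seen since the last reset: an automaton is only ever removed in favour of
   another one in the same state.  So a reset happens at the first event that
   completes an occurrence lying after the previous reset, and every occurrence
   of the episode contains, between its first and its last event, the last event
   of some tracked occurrence.  Mapping each member of a non-overlapped set to
   such a tracked occurrence is injective, which gives maximality. *)

(** * Equality on automata, so that membership in lists of automata makes sense *)

Section AutomatonEqType.

Variable n : nat.

Definition automaton_pair (a : automaton n) := (birth a, accepted a).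
Definition pair_automaton (p : nat * seq 'I_n) := Automaton p.1 p.2.

Lemma automaton_pairK : cancel automaton_pair pair_automaton.
Proof. by case. Qed.

HB.instance Definition _ :=
  Equality.copy (automaton n) (can_type automaton_pairK).

End AutomatonEqType.

Section Correctness.

Variables (Sigma : finType) (n : nat) (D : n.-tuple (Sigma * nat)).
Variables (m : nat) (alpha : m.+1.-tuple Sigma).
Hypothesis time_incr : forall i j : 'I_n, i < j -> etime D i < etime D j.

Implicit Types (A : seq (automaton n)) (a : automaton n) (s : seq 'I_n).
Implicit Types (l : 'I_n) (h t : {ffun 'I_m.+1 -> 'I_n}).

(** * Index order in place of time order, and embedded prefixes of the episode *)

Lemma ltn_etime (i j : 'I_n) : (etime D i < etime D j) = (i < j).
Proof.
apply/idP/idP => [|/time_incr //]; case: (ltngtP i j) => // [|/val_inj ->].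
  by move=> /time_incr /ltnW; rewrite leqNgt => /negPf ->.
by rewrite ltnn.
Qed.

(** A partial occurrence of [alpha] inside the window [[b, k)]; its length is left free, so that one
    predicate describes automata in every state. *)
Definition embeds_prefix b k s : bool :=
  [&& all (fun i : 'I_n => b <= i < k) s,
      pairwise (fun i j : 'I_n => i < j) s
    & map (etype D) s == take (size s) alpha].

Lemma embeds_prefix_size b k s : embeds_prefix b k s -> size s <= m.+1.
Proof.
case/and3P=> _ _ /eqP/(congr1 size); rewrite size_map size_take size_tuple.
by case: ltnP => [/ltnW //|_ ->].
Qed.

Lemma embeds_prefixW b k k' s :
  k <= k' -> embeds_prefix b k s -> embeds_prefix b k' s.
Proof.
move=> le_kk' /and3P[sbk ss sa]; apply/and3P; split=> //.
by apply: sub_all sbk => i /andP[-> /leq_trans->].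
Qed.

Lemma take_rcons_eq s l :
  (map (etype D) (rcons s l) == take (size (rcons s l)) alpha) =
  (map (etype D) s == take (size s) alpha) &&
  (onth alpha (size s) == Some (etype D l)).
Proof.
rewrite map_rcons size_rcons; case: (ltnP (size s) (size alpha)) => [lt_s|ge_s].
  rewrite (take_nth (etype D l)) // eqseq_rcons; congr (_ && _).
  by rewrite onthE (nth_map (etype D l)) // eq_sym.
(* Once [s] has full length, [onth] yields [None] on the right, and on the left the sizes
   disagree. *)
rewrite [onth _ _]onth_default // andbF; apply/eqP => /(congr1 size).
by move: ge_s; rewrite size_take !size_rcons size_map !size_tuple; case: ifP; lia.
Qed.

Lemma embeds_prefix_rcons b l s :
  b <= l ->
  embeds_prefix b l.+1 (rcons s l) =
  embeds_prefix b l s && (onth alpha (size s) == Some (etype D l)).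
Proof.
move=> le_bl; rewrite /embeds_prefix all_rcons pairwise_rcons take_rcons_eq.
rewrite le_bl ltnS leqnn /= -!andbA andbA -all_predI; congr (_ && _).
by apply: eq_all => i /=; lia.
Qed.

(** In an increasing list below [l.+1], the index [l] can only occur as the last entry. *)
Lemma embeds_prefixS b l s :
  embeds_prefix b l.+1 s ->
  embeds_prefix b l s \/ exists2 s', s = rcons s' l &
    embeds_prefix b l s' /\ onth alpha (size s') = Some (etype D l).
Proof.
case/lastP: s => [|s x] sbl; first by left; rewrite /embeds_prefix /= take0.
have /and3P[+ + +] := sbl; rewrite all_rcons pairwise_rcons.
case/andP=> /andP[bx xl] sb /andP[sx ss] sa.
have [eq_xl|ne_xl] := eqVneq x l.
  right; exists s; first by rewrite eq_xl.
  by move: sbl; rewrite eq_xl embeds_prefix_rcons -?eq_xl // => /andP[-> /eqP].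
have lt_xl : x < l by rewrite -val_eqE /= in ne_xl; lia.
left; apply/and3P; split; rewrite ?all_rcons ?pairwise_rcons ?bx ?lt_xl ?sx //.
by apply/allP=> i i_s; move/allP/(_ i i_s): sx; move/allP/(_ i i_s): sb => /=; lia.
Qed.

(** * One transition of the automata, before the test for the final state *)

Section Step.

Variables (A : seq (automaton n)) (l : 'I_n).
Let w := fun a => waits_for alpha a (etype D l).
Let moved := [seq accept l a | a <- A & w a].

Definition next_automata : seq (automaton n) :=
  moved ++ [seq b <- [seq a <- A | ~~ w a] | ~~ superseded m moved b] ++
  [seq fresh n l.+1 | a <- A & w a && (astate a == 0)].

Inductive next_spec : automaton n -> Prop :=
| NextMoved a of a \in A & w a : next_spec (accept l a)
| NextKept a of a \in A & ~~ w a & ~~ superseded m moved a : next_spec a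
| NextSpawned a of a \in A & w a & astate a = 0 : next_spec (fresh n l.+1).

Lemma next_automataP a : reflect (next_spec a) (a \in next_automata).
Proof.
rewrite !mem_cat; apply: (iffP idP) => [/or3P[/mapP[b]|/[!mem_filter]|/mapP[b]]|].
- by rewrite mem_filter => /andP[wb bA] ->; exact: NextMoved.
- by case/and3P=> *; exact: NextKept.
- by rewrite mem_filter => /andP[/andP[wb /eqP b0] bA] ->; exact: NextSpawned bA wb b0.
- case=> {}a aA wa => [|na|a0].
  + by rewrite map_f // mem_filter wa.
  + by rewrite !mem_filter aA wa na orbT.
  + apply/or3P/Or33/mapP; exists a => //; by rewrite mem_filter wa a0 aA.
Qed.

End Step.

(** * Invariant of the automata between two resets *)

Lemma astate_accept l a : astate (accept l a) = (astate a).+1.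
Proof. by rewrite /astate size_rcons. Qed.

(** Here [b] is the position of the last reset and [k] the number of events processed. [inv_order]
    ensures that in any collision the automaton that stayed is the older one, so the removal rule
    applies and preserves [inv_inj]. [inv_birth] makes a spawned automaton strictly younger than all
    others. *)
Record automata_inv b k A : Prop := AutomataInv {
  inv_embeds : {in A, forall a, embeds_prefix b k (accepted a)};
  inv_birth : {in A, forall a, birth a <= k};
  inv_order : {in A &, forall a a', astate a < astate a' -> birth a' < birth a};
  inv_inj : {in A &, injective (@astate n)};
  inv_complete : forall s, embeds_prefix b k s ->
    exists2 a, a \in A & size s <= astate a }.

Lemma automata_inv_fresh k : automata_inv k k [:: fresh n k].
Proof.
split=> [a|a|a a'|a a'|s]; rewrite ?inE.
- by move/eqP->; rewrite /embeds_prefix /= take0.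
- by move/eqP->.
- by move=> /eqP-> /eqP->.
- by move=> /eqP-> /eqP->.
case: s => [|x s]; first by exists (fresh n k); rewrite ?inE.
by case/and3P => /= /andP[]; lia.
Qed.

Lemma automata_inv_next b l A :
  b <= l -> {in A, forall a, astate a < m.+1} -> automata_inv b l A ->
  automata_inv b l.+1 (next_automata A l).
Proof.
move=> le_bl ltA [embA birA ordA injA cplA].
have not_superseded a a' : a \in A -> waits_for alpha a (etype D l) ->
    a' \in A -> ~~ superseded m
      [seq accept l c | c <- A & waits_for alpha c (etype D l)] a' ->
    birth a' < birth a -> (astate a).+1 != astate a'.
  move=> aA wa a'A na' lt_b; apply: contraNneq na' => eq_s.
  apply/hasP; exists (accept l a); first by rewrite map_f // mem_filter wa.
  (* The collision happens in the state of [a'], which is not final, so it lies in the range where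
     [superseded] acts. *)
  by rewrite astate_accept eq_s eqxx lt_b (ltA a') // -eq_s.
(* Automata are moved, kept or spawned: three cases each for [inv_embeds] and [inv_birth], then nine
   pairs each for [inv_order] and [inv_inj]. *)
split=> [_ /next_automataP[a aA wa|a aA wa _|a aA wa a0]|
         _ /next_automataP[a aA wa|a aA wa _|a aA wa a0]|
         _ _ /next_automataP[a aA wa|a aA wa na|a aA wa a0]
             /next_automataP[a' aA' wa'|a' aA' wa' na'|a' aA' wa' a0']|
         _ _ /next_automataP[a aA wa|a aA wa na|a aA wa a0]
             /next_automataP[a' aA' wa'|a' aA' wa' na'|a' aA' wa' a0']|s].
- by rewrite embeds_prefix_rcons // embA.
- exact: embeds_prefixW (embA a aA).
- by rewrite /embeds_prefix /= take0.
- by rewrite (leq_trans (birA a aA)).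
- by rewrite (leq_trans (birA a aA)).
- by [].
- by rewrite !astate_accept ltnS; apply: ordA.
- by rewrite astate_accept => /ltnW; exact: ordA.
- by [].
(* If both were in the same state before the event, they would be one automaton that both stays and
   moves. *)
- rewrite astate_accept ltnS leq_eqVlt => /predU1P[/injA eq_aa'|]; last exact: ordA.
  by rewrite eq_aa' ?wa' in wa.
- exact: ordA.
- by [].
- by move=> _; rewrite /= ltnS birA.
- by move=> _; rewrite /= ltnS birA.
- by [].
- by rewrite !astate_accept => -[/injA->].
- rewrite astate_accept => eq_s.
  have lt_b : birth a' < birth a by apply: ordA => //; rewrite -eq_s.
  by have := not_superseded a a' aA wa aA' na' lt_b; rewrite eq_s eqxx.
- by rewrite astate_accept.
- rewrite astate_accept => eq_s.
  have lt_b : birth a < birth a' by apply: ordA => //; rewrite eq_s.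
  by have := not_superseded a' a aA' wa' aA na lt_b; rewrite eq_s eqxx.
- exact: injA.
(* A spawn means that the only automaton in state 0 has moved, so none can have stayed there. *)
- by move=> a0; case/negP: wa; rewrite (injA a a') // a0 a0'.
- by rewrite astate_accept.
- by move=> a0'; case/negP: wa'; rewrite (injA a' a) // -a0' a0.
- by [].
(* Progress is never lost: an automaton survives, advances, or is removed in favour of one in the
   same state. *)
have keep a : a \in A ->
    exists2 a', a' \in next_automata A l & astate a <= astate a'.
  move=> aA; have [wa|wa] := boolP (waits_for alpha a (etype D l)).
    exists (accept l a); last by rewrite astate_accept.
    exact/next_automataP/NextMoved.
  have [/hasP[a' a'M /and3P[_ /eqP eq_s _]]|na] := boolP (superseded m
      [seq accept l c | c <- A & waits_for alpha c (etype D l)] a).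
    by exists a'; rewrite ?eq_s // mem_cat a'M.
  by exists a => //; apply/next_automataP/NextKept.
case/embeds_prefixS => [/cplA[a /keep[a' a'A le_a] le_s]|[s' -> [es' ts']]].
  by exists a' => //; apply: leq_trans le_a.
rewrite size_rcons; have [a aA] := cplA s' es'.
(* If [a] is exactly in state [size s'], it waits for the type of [l] and accepts it; otherwise it
   is already far enough. *)
rewrite leq_eqVlt => /predU1P[eq_s|lt_s].
  exists (accept l a); last by rewrite astate_accept eq_s.
  by apply/next_automataP/NextMoved; rewrite // /waits_for -eq_s ts'.
by have [a' a'A le_a] := keep a aA; exists a' => //; apply: leq_trans le_a.
Qed.

(** * Occurrences as embedded lists of full length *)

Lemma occurrence_embeds h b k :
  occurrence D alpha h -> b <= h ord0 -> h ord_max < k ->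
  embeds_prefix b k [seq h i | i <- enum 'I_m.+1].
Proof.
move=> [type_h time_h] le_b lt_k.
have mono (i j : 'I_m.+1) : i < j -> h i < h j.
  by move/time_h; rewrite ltn_etime.
have monoW (i j : 'I_m.+1) : i <= j -> h i <= h j.
  by rewrite leq_eqVlt => /predU1P[/val_inj->|/mono/ltnW].
apply/and3P; split.
- apply/allP=> _ /mapP[i _ ->]; rewrite (leq_trans le_b) ?monoW //=.
  by rewrite (leq_ltn_trans _ lt_k) // monoW // -ltnS.
- rewrite pairwise_map; apply: (@sub_pairwise _ (relpre val ltn)) => [i j|].
    exact: mono.
  rewrite -pairwise_map val_enum_ord -sorted_pairwise ?iota_ltn_sorted //.
  exact: ltn_trans.
apply/eqP; rewrite size_map size_enum_ord -map_comp take_oversize ?size_tuple //.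
by rewrite -[RHS]map_tnth_enum; apply: eq_map => i /=; rewrite type_h.
Qed.

(** The bound on [h ord0] is what separates a newly tracked occurrence from those completed before
    the reset at [b]. *)
Lemma embeds_occurrence b k l s :
  embeds_prefix b k s -> size s = m.+1 ->
  let h := [ffun i : 'I_m.+1 => nth l s i] in
  occurrence D alpha h /\ b <= h ord0.
Proof.
move=> /and3P[sb ss /eqP sa] sz h; split; last first.
  by rewrite ffunE; move/(all_nthP l)/(_ 0): sb; rewrite sz => /(_ isT) /andP[].
split=> [i|i j lt_ij]; rewrite !ffunE.
  rewrite (tnth_nth (etype D l)) -(nth_map _ (etype D l)) ?sz //.
  by rewrite sa sz take_oversize ?size_tuple.
rewrite ltn_etime; move/(pairwiseP l): ss; apply=> //; by rewrite inE sz.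
Qed.

(** * Invariant of the whole run *)

Definition before h t := (h ord_max : nat) < t ord0.

(** [run_hit] is the property behind maximality. [run_reset] serves to preserve it: an occurrence
    that straddles the reset position [b] is hit by the tracked occurrence that caused the reset. *)
Record run_inv k (r : run_state n m) b : Prop := RunInv {
  run_reset_le : b <= k;
  run_automata : automata_inv b k (automata r);
  run_states : {in automata r, forall a, astate a < m.+1};
  run_occurrence : forall h, h \in tracked r -> occurrence D alpha h;
  run_before : forall h, h \in tracked r -> h ord_max < b;
  run_disjoint : {in tracked r &, forall h t, [\/ h = t, before h t | before t h]};
  run_reset : b = 0 \/ exists2 t, t \in tracked r & (t ord_max).+1 = b;
  run_hit : forall h, occurrence D alpha h -> h ord_max < k ->
    exists2 t, t \in tracked r & h ord0 <= t ord_max <= h ord_max }.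

Lemma run_inv_init : run_inv 0 (noi_init n m) 0.
Proof.
split=> //; first exact: automata_inv_fresh.
- by move=> a; rewrite inE => /eqP->.
- by left.
Qed.

Lemma noi_stepE (r : run_state n m) l :
  let A' := next_automata (automata r) l in
  let final := [seq a <- A' | astate a == m.+1] in
  noi_step D alpha r l =
  if nilp final then RunState A' (frequency r) (tracked r)
  else RunState [:: fresh n l.+1] (frequency r).+1
         (tracked r ++ [seq tracked_by m l a | a <- final]).
Proof. by []. Qed.

Lemma run_inv_step (r : run_state n m) b l :
  run_inv l r b -> exists b', run_inv l.+1 (noi_step D alpha r l) b'.
Proof.
case=> le_bl autA ltA occT befT disT resT hitT.
rewrite noi_stepE; set A' := next_automata _ _; set final := filter _ A'.
have autA' : automata_inv b l.+1 A' by exact: automata_inv_next.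
have [embA' _ _ injA' cplA'] := autA'.
have leA' a : a \in A' -> astate a <= m.+1 by move/embA'/embeds_prefix_size.
have [/nilP fin0|] := boolP (nilp final).
  exists b; have ltA' : {in A', forall a, astate a < m.+1}.
    move=> a aA'; rewrite ltn_neqAle leA' // andbT; apply/negP => a_fin.
    by have : a \in final; [rewrite mem_filter a_fin|rewrite fin0].
  split=> //; first exact: leqW.
  move=> h occ_h; rewrite ltnS leq_eqVlt => /predU1P[end_h|]; last exact: hitT.
  (* An occurrence inside the current window would, by completeness, put some automaton in the final
     state; one that starts before [b] contains the event of the last reset. *)
  have [le_bh|lt_hb] := leqP b (h ord0).
    have [|a aA'] := cplA' _ (@occurrence_embeds h b l.+1 occ_h le_bh _).
      by rewrite end_h.
    by rewrite size_map size_enum_ord leqNgt ltA'.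
  case: resT => [b0|[t tT eq_b]]; first by rewrite b0 in lt_hb.
  by exists t => //; rewrite -ltnS eq_b lt_hb end_h -ltnS eq_b leqW.
have fin_last a : a \in final ->
    [/\ occurrence D alpha (tracked_by m l a), b <= tracked_by m l a ord0
      & tracked_by m l a ord_max = l].
  rewrite mem_filter => /andP[/eqP sz_a aA'].
  have [occ_a ge_b] := embeds_occurrence l (embA' a aA') sz_a.
  (* No automaton was final before this event, so a final one has just moved and its last accepted
     event is [l]. *)
  split=> //; case/next_automataP: aA' sz_a => [c cA wc|c cA _ _|//].
    rewrite astate_accept ffunE => -[sz_c] /=; rewrite nth_rcons.
    by rewrite -/(astate c) sz_c ltnn eqxx.
  by move=> sz_c; have := ltA c cA; rewrite sz_c ltnn.
case def_fin: final => [//|a0 fin'] _; rewrite -def_fin.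
have a0_fin : a0 \in final by rewrite def_fin mem_head.
(* Automata occupy distinct states, so each reset adds a single occurrence. *)
have fin_eq a : a \in final -> a = a0.
  move: a0_fin; rewrite !mem_filter => /andP[/eqP s0 a0A] /andP[/eqP sa aA].
  by apply: injA' => //; rewrite sa.
have trackedP h : h \in tracked r ++ [seq tracked_by m l a | a <- final] ->
    h \in tracked r \/ h = tracked_by m l a0.
  rewrite mem_cat => /orP[|/mapP[a /fin_eq-> ->]]; first by left.
  by right.
have new_in : tracked_by m l a0 \in
    tracked r ++ [seq tracked_by m l a | a <- final].
  by rewrite mem_cat map_f ?orbT.
have [occ0 ge0 end0] := fin_last _ a0_fin.
exists l.+1; split=> //=.
- exact: automata_inv_fresh.
- by move=> a; rewrite inE => /eqP->.
- by move=> h /trackedP[/occT|->].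
- move=> h /trackedP[/befT lt_b|->]; last by rewrite end0.
  exact: leq_trans lt_b (leqW le_bl).
- move=> h t /trackedP[hT|->] /trackedP[tT|->]; first exact: disT.
  + by constructor 2; apply: leq_trans (befT h hT) ge0.
  + by constructor 3; apply: leq_trans (befT t tT) ge0.
  + by constructor 1.
- by right; exists (tracked_by m l a0); rewrite ?end0.
move=> h occ_h; rewrite ltnS leq_eqVlt => /predU1P[end_h|lt_h].
  exists (tracked_by m l a0) => //; rewrite end0 end_h leqnn andbT -end_h.
  (* For a one-node episode the first and last nodes coincide, and strict monotonicity of times says
     nothing. *)
  case: occ_h => _ time_h; case: (posnP (ord_max : 'I_m.+1)) => [max0|max_gt0].
    by rewrite (_ : ord0 = ord_max) //; apply: val_inj.
  by apply: ltnW; rewrite -ltn_etime time_h.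
have [t tT t_h] := hitT h occ_h lt_h.
by exists t; rewrite // mem_cat tT.
Qed.

(** * The invariant at the end of the run, and maximality *)

Lemma run_inv_take k :
  k <= n ->
  exists b, run_inv k (foldl (noi_step D alpha) (noi_init n m)
                         (take k (enum 'I_n))) b.
Proof.
elim: k => [|k IHk] lt_kn; first by exists 0; rewrite take0; exact: run_inv_init.
have [b] := IHk (ltnW lt_kn); pose l := Ordinal lt_kn.
rewrite (take_nth l) ?size_enum_ord // foldl_rcons.
by rewrite (nth_ord_enum l l : nth l _ k = l) => /(@run_inv_step _ _ l).
Qed.

Lemma noi_run_inv : exists b, run_inv n (noi_run D alpha) b.
Proof.
have := run_inv_take (leqnn n).
by rewrite take_oversize ?size_enum_ord.
Qed.

Lemma noi_tracked_maximal :
  maximal_non_overlapped D alpha (noi_tracked D alpha).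
Proof.
have [b [_ _ _ occT _ disT _ hitT]] := noi_run_inv.
split=> [h|h t|H occH disH].
- by rewrite inE; exact: occT.
- rewrite !inE => hT tT ne_ht; case: (disT h t hT tT) => [eq_ht|ht|th].
  + by rewrite eq_ht eqxx in ne_ht.
  + by left; rewrite ltn_etime.
  + by right; rewrite ltn_etime.
pose hit h t := h ord0 <= t ord_max <= h ord_max.
(* For [h] in [H] the default is never returned: the hitting property at [k = n] covers every
   occurrence. *)
pose f h := odflt h [pick t in noi_tracked D alpha | hit h t].
have fP h : h \in H -> f h \in noi_tracked D alpha /\ hit h (f h).
  move=> hH; rewrite /f; case: pickP => [t /andP[]//|no_t].
  have [t tT hit_t] := hitT h (occH h hH) (ltn_ord _).
  by have := no_t t; rewrite inE tT /hit hit_t.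
have f_inj : {in H &, injective f}.
  move=> h1 h2 h1H h2H eq_f; apply/eqP/negP => /negP ne_h.
  have [_ /andP[lo1 hi1]] := fP h1 h1H; have [_] := fP h2 h2H.
  rewrite -eq_f => /andP[lo2 hi2].
  (* The last event of the common image lies in the spans of both [h1] and [h2], which are
     disjoint. *)
  by case: (disH h1 h2 h1H h2H ne_h); rewrite ltn_etime; lia.
rewrite -(card_in_imset f_inj); apply/subset_leq_card/subsetP => t.
by case/imsetP=> h /fP[fT _] ->.
Qed.

End Correctness.

Theorem mainTheorem5 (Sigma : finType) (n : nat) (D : n.-tuple (Sigma * nat))
    (m : nat) (alpha : m.+1.-tuple Sigma)
    (time_pos : forall i : 'I_n, 0 < etime D i)
    (time_incr : forall i j : 'I_n, i < j -> etime D i < etime D j) :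
  maximal_non_overlapped D alpha (noi_tracked D alpha).
Proof. exact: noi_tracked_maximal. Qed.
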